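(* A curve $\gamma$ lying in the $xy$-plane and making constant angle $\theta$ with the Killing vector field $V=-y\,\frac{\partial}{\partial x}+x\,\frac{\partial}{\partial y}$ is a) either the circle $\mathcal{C}(r_0)$ centered at the origin and of radius $r_0$; b) or a straight line passing through the origin; c) or the logarithmic spiral given in polar coordinates by $r(\phi)=e^{\tan\theta\,(\phi-\phi_0)}$.
   Context: The curve $\gamma=(\gamma_1,\gamma_2):I\to\mathbb{R}^2$, $I\subset\mathbb{R}$ an interval, is smooth, parametrized by arc length and does not pass through the origin (where $V$ vanishes). At a point $(x,y)$ the field $V$ takes the value $(-y,x)$. The curve makes constant angle $\theta$ with $V$ if the angle between $\gamma'(s)$ and $V_{\gamma(s)}$ equals the constant $\theta$ for all $s\in I$, i.e. $-\gamma_1'\gamma_2+\gamma_2'\gamma_1=\sqrt{\gamma_1^2+\gamma_2^2}\,\cos\theta$. Polar coordinates are $x=r\cos\phi$, $y=r\sin\phi$ with $r>0$. Here $r_0>0$ and $\phi_0\in\mathbb{R}$ are constants. The statement is local: ''is'' means that $\gamma$ is (part of) one of the listed curves.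
   Formalization: In c) the spiral is r = e^{tan θ(φ−φ0)} or r = e^{−tan θ(φ−φ0)}, with cos θ ≠ 0: the angle condition fixes only cos θ, so inward spirals with the opposite sign also make the constant angle θ, and c) with only +tan θ fails for them. *)

(* Defs.v *)
From HB Require Import structures.
From mathcomp Require Import all_boot all_order all_algebra.
From mathcomp Require Import all_classical all_reals all_analysis.
Import Order.TTheory GRing.Theory Num.Theory.
Import numFieldNormedType.Exports.

Set Implicit Arguments.
Unset Strict Implicit.
Unset Printing Implicit Defensive.

Local Open Scope classical_set_scope.
Local Open Scope ring_scope.

Definition dot (R : realType) (u v : R * R) : R := u.1 * v.1 + u.2 * v.2.

(* The norm [`|u|] that the library puts on [R * R] is the sup norm. *)
Definition enorm (R : realType) (u : R * R) : R := Num.sqrt (dot u u).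

(* Only [cos theta] is determined: this is the unoriented angle, for which
   [theta] and [- theta] are interchangeable. *)
Definition has_angle (R : realType) (u v : R * R) (theta : R) : Prop :=
  dot u v = enorm u * enorm v * cos theta.

Definition killing_field (R : realType) (p : R * R) : R * R := (- p.2, p.1).

(* The interval [I] may contain its endpoints; smoothness there means, as usual,
   that the curve is the restriction of one that is smooth on an open set.
   The total function [gamma] is such an extension. *)
Definition smooth_on (R : realType) (I : set R) (gamma : R -> R * R) : Prop :=
  exists2 U : set R, open U & I `<=` U /\
    forall (n : nat) (s : R), U s -> derivable (derive1n n gamma) s 1.

Definition arc_length_parametrized (R : realType) (I : set R)
    (gamma : R -> R * R) : Prop :=
  forall s, I s -> enorm (derive1 gamma s) = 1.

Definition constant_angle (R : realType) (I : set R) (gamma : R -> R * R)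
    (V : R * R -> R * R) (theta : R) : Prop :=
  forall s, I s -> has_angle (derive1 gamma s) (V (gamma s)) theta.

Definition polar (R : realType) (r phi : R) : R * R :=
  (r * cos phi, r * sin phi).

Definition origin_circle (R : realType) (r0 : R) : set (R * R) :=
  [set p | enorm p = r0].

Definition origin_line (R : realType) (v : R * R) : set (R * R) :=
  [set p | exists t : R, p = (t * v.1, t * v.2)].

Definition log_spiral (R : realType) (theta phi0 : R) : set (R * R) :=
  [set p | exists phi : R, p = polar (expR (tan theta * (phi - phi0))) phi].

(* Main.v *)
(* Since |V| = rho := |gamma| and V is orthogonal to the position vector,
   Lagrange's identity gives (rho')^2 = sin^2 theta.  The function rho' is
   continuous, so it is constant on I, equal to sin psi with psi = theta or
   psi = - theta.  On the other hand the polar angle phi satisfies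
   phi' = cos theta / rho.  If sin theta = 0 then rho is constant, and if
   cos theta = 0 then phi is constant; otherwise phi - ln rho / tan psi is. *)
Require Import Defs.
From mathcomp Require Import all_boot all_order all_algebra.
From mathcomp Require Import all_classical all_reals all_analysis.
From mathcomp Require Import ring.
Import Order.TTheory GRing.Theory Num.Theory.
Import numFieldNormedType.Exports.

Local Open Scope classical_set_scope.
Local Open Scope ring_scope.

(** The projection is continuous and commutes with difference quotients, so the limit passes through
    it. *)
Lemma is_derive_fst (R : numFieldType) (V W1 W2 : normedModType R)
    (f : V -> W1 * W2) (x v : V) (df : W1 * W2) :
  is_derive x v f df -> is_derive x v (fst \o f) df.1.
Proof.
move=> [df_ex <-].
have /(@cvg_comp _ _ _ _ fst) /(_ cvg_fst) c := df_ex.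
by split; [apply/cvg_ex; exists ('D_v f x).1|apply: cvg_lim].
Qed.

Lemma is_derive_snd (R : numFieldType) (V W1 W2 : normedModType R)
    (f : V -> W1 * W2) (x v : V) (df : W1 * W2) :
  is_derive x v f df -> is_derive x v (snd \o f) df.2.
Proof.
move=> [df_ex <-].
have /(@cvg_comp _ _ _ _ snd) /(_ cvg_snd) c := df_ex.
by split; [apply/cvg_ex; exists ('D_v f x).2|apply: cvg_lim].
Qed.

Arguments is_derive_fst {R V W1 W2 f x v df}.
Arguments is_derive_snd {R V W1 W2 f x v df}.

Section PlaneVectors.
Context {R : realType}.
Implicit Types (u v : R * R).

Lemma dotuu_ge0 u : 0 <= dot u u.
Proof. by rewrite addr_ge0 // -expr2 sqr_ge0. Qed.

Lemma sqr_enorm u : enorm u ^+ 2 = dot u u.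
Proof. by rewrite sqr_sqrtr // dotuu_ge0. Qed.

Lemma dotuu_gt0 u : u <> (0, 0) -> 0 < dot u u.
Proof.
case: u => x y xy0; rewrite lt_neqAle dotuu_ge0 andbT eq_sym /dot /=.
rewrite -!expr2 paddr_eq0 ?sqr_ge0 // !sqrf_eq0.
by apply/negP => /andP[/eqP x0 /eqP y0]; apply: xy0; rewrite x0 y0.
Qed.

Lemma enorm_gt0 u : u <> (0, 0) -> 0 < enorm u.
Proof. by move=> u0; rewrite sqrtr_gt0 dotuu_gt0. Qed.

Lemma enorm_killing_field u : enorm (killing_field u) = enorm u.
Proof. by congr Num.sqrt; rewrite /dot /=; ring. Qed.

(** [killing_field u] is [u] turned by a right angle, so the second square is that of the cross
    product of [u] and [v]. *)
Lemma lagrange_identity u v :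
  dot u v ^+ 2 + dot v (killing_field u) ^+ 2 = dot u u * dot v v.
Proof. by rewrite /dot /killing_field /=; ring. Qed.

(** [acos x] is the right angle up to sign; the sign of [y] decides. *)
Lemma exists_angle (x y : R) : x ^+ 2 + y ^+ 2 = 1 ->
  exists t, x = cos t /\ y = sin t.
Proof.
move=> xy1.
have x11 : -1 <= x <= 1.
  rewrite -ler_norml -(expr_le1 (n := 2)) // real_normK ?num_real //.
  by rewrite -xy1 lerDl sqr_ge0.
have sE : sin (acos x) = `|y|.
  by rewrite sin_acos // -xy1 addrC addKr sqrtr_sqr.
have [y0|y0] := leP 0 y.
  by exists (acos x); rewrite acosK // sE ger0_norm.
by exists (- acos x); rewrite cosN sinN acosK // sE ltr0_norm // opprK.
Qed.

End PlaneVectors.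

Lemma is_derive_dot (R : realType) (f g : R -> R * R) (s : R) (df dg : R * R) :
  is_derive s 1 f df -> is_derive s 1 g dg ->
  is_derive s 1 (fun t => dot (f t) (g t)) (dot (f s) dg + dot (g s) df).
Proof.
move=> Df Dg.
have := is_deriveD
  (is_deriveM (is_derive_fst Df) (is_derive_fst Dg))
  (is_deriveM (is_derive_snd Df) (is_derive_snd Dg)).
move/is_derive_eq; apply.
by rewrite /GRing.scale /dot /=; ring.
Qed.

Arguments is_derive_dot {R f g s df dg}.

Lemma is_derive_enorm (R : realType) (f : R -> R * R) (s : R) (df : R * R) :
  is_derive s 1 f df -> f s <> (0, 0) ->
  is_derive s 1 (fun t => enorm (f t)) (dot (f s) df / enorm (f s)).
Proof.
move=> Df fs0.
have := @is_derive1_comp R Num.sqrt (fun t => dot (f t) (f t)) s _ _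
  (is_derive1_sqrt (dotuu_gt0 _ fs0)) (is_derive_dot Df Df).
move/is_derive_eq; apply.
by rewrite -/(enorm _); field; rewrite gt_eqF // enorm_gt0.
Qed.

Arguments is_derive_enorm {R f s df}.

Section IntervalFunctions.
Context {R : realType} (I : set R).
Hypothesis I_interval : is_interval I.
Implicit Types f : R -> R.

Lemma derivable_on_within f a b : I a -> I b ->
  (forall s, I s -> derivable f s 1) -> {within `[a, b], continuous f}.
Proof.
move=> Ia Ib Df; apply: derivable_within_continuous => s.
by rewrite in_itv /= => sab; apply: Df; apply: I_interval sab.
Qed.

(** Mean value theorem on the segment between [a] and [b], which lies in [I]. *)
Lemma derive0_constant f : (forall s, I s -> is_derive s 1 f 0) ->
  forall a b, I a -> I b -> f a = f b.
Proof.
move=> Df; suff fle a b : I a -> I b -> a <= b -> f a = f b.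
  by move=> a b Ia Ib; have [ab|/ltW ba] := leP a b;
    [apply: fle|apply/esym/fle].
move=> Ia Ib ab.
have [||c _] := @MVT_segment _ f (fun=> 0) a b ab.
- move=> s; rewrite in_itv /= => /andP[as_ sb]; apply: Df.
  by apply: (I_interval a b) => //; rewrite !ltW.
- by apply: derivable_on_within => // s /Df [].
by rewrite mul0r => /eqP; rewrite subr_eq0 => /eqP.
Qed.

(** If [f a = - f b], the intermediate value theorem gives a zero of [f] in between; there
    [c ^+ 2 = 0], so [f] vanishes on all of [I]. *)
Lemma sqr_constant f (c : R) : (forall s, I s -> derivable f s 1) ->
  (forall s, I s -> f s ^+ 2 = c ^+ 2) -> forall a b, I a -> I b -> f a = f b.
Proof.
move=> Df f2; suff fle a b : I a -> I b -> a <= b -> f a = f b.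
  by move=> a b Ia Ib; have [ab|/ltW ba] := leP a b;
    [apply: fle|apply/esym/fle].
move=> Ia Ib ab.
have /eqP : f a ^+ 2 = f b ^+ 2 by rewrite !f2.
rewrite eqf_sqr => /orP[/eqP //|/eqP faN].
have [|t] := IVT (v := 0) ab (derivable_on_within _ _ _ Ia Ib Df).
  rewrite faN; have [fb0|fb0] := leP 0 (f b).
    by rewrite ge_min le_max oppr_le0 fb0 /= orbT.
  by rewrite ge_min le_max oppr_ge0 (ltW fb0) /= orbT.
rewrite in_itv /= => tab ft0.
have c0 : c ^+ 2 = 0 by rewrite -(f2 t) ?ft0 ?expr0n //; apply: I_interval tab.
have f0 s : I s -> f s = 0.
  by move=> /f2 /eqP; rewrite c0 sqrf_eq0 => /eqP.
by rewrite !f0.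
Qed.

End IntervalFunctions.

Section PolarLift.
Context {R : realType} (I : set R) (g dg : R -> R * R) (phi : R -> R).
Hypothesis I_interval : is_interval I.
Hypothesis I_neq0 : I !=set0.
Hypothesis g_neq0 : forall s, I s -> g s <> (0, 0).
Hypothesis Dg : forall s, I s -> is_derive s 1 g (dg s).
(** The quotient is (x y' - y x') / (x^2 + y^2), the derivative of the polar angle of [g]. *)
Hypothesis Dphi : forall s, I s ->
  is_derive s 1 phi (dot (dg s) (killing_field (g s)) / enorm (g s) ^+ 2).

Let rho s := enorm (g s).

(* The unit vector g / |g| rotated by - phi is constant along the curve. *)
Lemma polar_lift :
  exists k, forall s, I s -> g s = polar (enorm (g s)) (phi s + k).
Proof.
pose x := fst \o g; pose y := snd \o g.
pose A : R -> R := (x * (cos \o phi) + y * (sin \o phi)) * (fun s => (rho s)^-1).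
pose B : R -> R := (y * (cos \o phi) - x * (sin \o phi)) * (fun s => (rho s)^-1).
have DAB s : I s -> is_derive s 1 A 0 /\ is_derive s 1 B 0.
  move=> Is.
  have rho0 : rho s != 0 by rewrite gt_eqF // enorm_gt0 //; exact: g_neq0.
  have Dx : is_derive s 1 x (dg s).1 by exact: is_derive_fst (Dg _ Is).
  have Dy : is_derive s 1 y (dg s).2 by exact: is_derive_snd (Dg _ Is).
  have Dc := is_derive1_comp (is_derive_cos (phi s)) (Dphi _ Is).
  have Ds := is_derive1_comp (is_derive_sin (phi s)) (Dphi _ Is).
  have Dr : is_derive s 1 (fun s => (rho s)^-1) _ :=
    is_deriveV rho0 (is_derive_enorm (Dg _ Is) (g_neq0 _ Is)).
  have rE : rho s ^+ 2 - (x s ^+ 2 + y s ^+ 2) = 0.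
    by rewrite sqr_enorm /dot -!expr2 subrr.
  split; apply: is_derive_eq; rewrite /GRing.scale /=.
  (* For [field], [rho s] is independent of the coordinates; the factor that vanishes by [rE] is
     therefore split off explicitly. *)
  - transitivity (((dg s).1 * cos (phi s) + (dg s).2 * sin (phi s)) / rho s ^+ 3
      * (rho s ^+ 2 - (x s ^+ 2 + y s ^+ 2))); last by rewrite rE mulr0.
    rewrite !fctE /dot /killing_field /x /y /rho /=; field; exact: rho0.
  - transitivity (((dg s).2 * cos (phi s) - (dg s).1 * sin (phi s)) / rho s ^+ 3
      * (rho s ^+ 2 - (x s ^+ 2 + y s ^+ 2))); last by rewrite rE mulr0.
    rewrite !fctE /dot /killing_field /x /y /rho /=; field; exact: rho0.
have [s0 Is0] := I_neq0.
have rot s : I s -> rho s != 0 /\ A s ^+ 2 + B s ^+ 2 = 1.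
  move=> Is.
  have rho0 : rho s != 0 by rewrite gt_eqF // enorm_gt0 //; exact: g_neq0.
  split=> //.
  have rE : x s ^+ 2 + y s ^+ 2 = rho s ^+ 2 by rewrite sqr_enorm /dot -!expr2.
  transitivity ((cos (phi s) ^+ 2 + sin (phi s) ^+ 2)
      * (x s ^+ 2 + y s ^+ 2) / rho s ^+ 2).
    by rewrite /A /B !fctE /=; field.
  by rewrite rE cos2Dsin2 mul1r divff // expf_neq0.
(* The offset [k] is the angle of the unit vector ([A], [B]), read off at the base point [s0]. *)
have [k [Ak Bk]] := exists_angle _ _ (rot _ Is0).2.
exists k => s Is; have [rho0 _] := rot _ Is.
have As : A s = cos k.
  by rewrite -Ak; apply: (derive0_constant _ I_interval) => // t /DAB [].
have Bs : B s = sin k.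
  by rewrite -Bk; apply: (derive0_constant _ I_interval) => // t /DAB [].
(* Rotating ([A], [B]) back by [phi s] recovers [g s], by cos^2 + sin^2 = 1. *)
rewrite /polar cosD sinD -As -Bs [LHS]surjective_pairing -/(rho s).
have cs := cos2Dsin2 (phi s).
congr pair.
- transitivity (x s * (cos (phi s) ^+ 2 + sin (phi s) ^+ 2)).
    by rewrite cs mulr1.
  by rewrite /A /B !fctE /=; field.
- transitivity (y s * (cos (phi s) ^+ 2 + sin (phi s) ^+ 2)).
    by rewrite cs mulr1.
  by rewrite /A /B !fctE /=; field.
Qed.

End PolarLift.

Theorem theorem1 (R : realType) (I : set R) (gamma : R -> R * R) (theta : R)
    (I_interval : is_interval I)
    (gamma_smooth : smooth_on I gamma)
    (gamma_unit : arc_length_parametrized I gamma)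
    (gamma_neq0 : forall s, I s -> gamma s <> (0, 0))
    (gamma_angle : constant_angle I gamma (@killing_field R) theta) :
  (exists2 r0 : R, 0 < r0 & gamma @` I `<=` origin_circle r0)
  \/ (exists2 v : R * R, v <> (0, 0) & gamma @` I `<=` origin_line v)
  \/ (cos theta <> 0 /\
      exists phi0 : R, gamma @` I `<=` log_spiral theta phi0
                    \/ gamma @` I `<=` log_spiral (- theta) phi0).
Proof.
have [U _ [IU gammaU]] := gamma_smooth.
have Dgamma s : I s -> is_derive s 1 gamma (derive1 gamma s).
  by move=> /IU /(gammaU 0%N); rewrite derive1n0 derive1E; exact: derivableP.
have Dgamma' s : I s -> derivable (derive1 gamma) s 1.
  by move=> /IU /(gammaU 1%N); rewrite derive1n1.
have [I0|/set0P[s0 Is0]] := eqVneq I set0.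
  by left; exists 1 => // p [s]; rewrite I0.
pose rho s := enorm (gamma s).
have rho_gt0 s : I s -> 0 < rho s by move=> /gamma_neq0; exact: enorm_gt0.
have angle s : I s ->
    dot (derive1 gamma s) (killing_field (gamma s)) = rho s * cos theta.
  move=> Is; rewrite (gamma_angle _ Is) gamma_unit // enorm_killing_field.
  by rewrite mul1r.
(* This is rho' as an explicit quotient, which makes its own differentiability, hence continuity,
   visible. *)
pose h s := dot (gamma s) (derive1 gamma s) / rho s.
have Drho s : I s -> is_derive s 1 rho (h s).
  by move=> Is; apply: is_derive_enorm; [exact: Dgamma|exact: gamma_neq0].
have Dh s : I s -> derivable h s 1.
  move=> Is; apply: derivableM.
    have := is_derive_dot (Dgamma _ Is) (derivableP (Dgamma' _ Is)).
    by case.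
  by apply: derivableV; [rewrite gt_eqF // rho_gt0|case: (Drho _ Is)].
(* Lagrange's identity reads (rho h)^2 + (rho cos theta)^2 = rho^2. *)
have h2 s : I s -> h s ^+ 2 = sin theta ^+ 2.
  move=> Is; have r0 : rho s ^+ 2 != 0 by rewrite expf_neq0 // gt_eqF // rho_gt0.
  apply: (mulIf r0); rewrite expr_div_n divfK //.
  have := lagrange_identity (gamma s) (derive1 gamma s).
  rewrite angle // -!sqr_enorm gamma_unit // -/(rho s) expr1n mulr1 exprMn.
  by move/(canRL (addrK _)) => ->; rewrite sin2cos2; ring.
have hE s : I s -> h s = h s0.
  by move=> Is; apply: (sqr_constant _ I_interval _ _ Dh h2).
have lift phi : (forall s, I s -> is_derive s 1 phi (cos theta / rho s)) ->
    exists k, forall s, I s -> gamma s = polar (rho s) (phi s + k).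
  move=> Dphi; apply: (polar_lift I _ (derive1 gamma)) => //; first by exists s0.
  move=> s Is; apply: is_derive_eq (Dphi _ Is) _.
  by rewrite angle // -/(rho s); field; rewrite gt_eqF // rho_gt0.
have [sin0|sin0] := eqVneq (sin theta) 0.
  left; exists (rho s0); first exact: rho_gt0.
  move=> _ [s Is <-]; apply: (derive0_constant I I_interval rho) => // t It.
  apply: is_derive_eq (Drho _ It) _.
  by apply/eqP; rewrite -sqrf_eq0 h2 // sin0 expr0n.
right; have [cos0|cos0] := eqVneq (cos theta) 0.
  (* The angular velocity is zero, so the polar angle is a constant [k] and the line has direction
     (cos k, sin k). *)
  left; have [|k kE] := lift (cst 0).
    by move=> s Is; rewrite cos0 mul0r; exact: is_derive_cst.
  exists (cos k, sin k).
    move=> [ck sk]; have := cos2Dsin2 k.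
    by rewrite ck sk expr0n addr0 => /esym/eqP; rewrite oner_eq0.
  by move=> _ [s Is <-]; exists (rho s); rewrite kE // /polar add0r.
right; split; first exact/eqP.
(* The data fix [theta] only up to sign; [psi] is the choice whose sine is the actual value of
   rho'. *)
have spiral psi : cos psi = cos theta -> h s0 = sin psi ->
    exists phi0, gamma @` I `<=` log_spiral psi phi0.
  move=> cpsi spsi.
  have cpsi0 : cos psi != 0 by rewrite cpsi.
  have spsi0 : sin psi != 0 by rewrite -spsi -sqrf_eq0 h2 // sqrf_eq0.
  have tan0 : tan psi != 0 by rewrite mulf_neq0 // invr_neq0.
  (* Since rho' = sin psi, this function has derivative cot psi * sin psi / rho = cos theta /
     rho. *)
  have [|k kE] := lift (fun s => (tan psi)^-1 * ln (rho s)).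
    move=> s Is.
    have := is_deriveZ (tan psi)^-1
      (is_derive1_comp (is_derive1_ln (rho_gt0 _ Is)) (Drho _ Is)).
    move/is_derive_eq; apply.
    rewrite hE // spsi -cpsi /tan /GRing.scale /=; field.
    by rewrite cpsi0 spsi0 gt_eqF // rho_gt0.
  (* With [phi0 := k] the exponent tan psi * (phi - k) is ln rho. *)
  exists k => _ [s Is <-]; exists ((tan psi)^-1 * ln (rho s) + k).
  by rewrite addrK mulrA divff // mul1r lnK // ?posrE ?rho_gt0 // kE.
have /eqP := h2 _ Is0; rewrite eqf_sqr => /orP[] /eqP hs0.
  by have [phi0 ?] := spiral theta erefl hs0; exists phi0; left.
have [||phi0 ?] := spiral (- theta); rewrite ?cosN ?sinN //.
by exists phi0; right.
Qed.
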